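(* Let $\mathbb{F}$ be a field and let $M\in\mathrm{GL}_n(\mathbb{F})$ be an invertible well-partitioned matrix. (a) For every monic polynomial $r\in\mathbb{F}[t]$ with degree $n$ such that $N(r)=\det M$, the matrix $M$ is u-adjacent to $C(r)$. (b) There exists $\eta\in\{1,-1\}$ such that, for every monic polynomial $r\in\mathbb{F}[t]$ with degree $n$ such that $N(r)=\eta\det M$, the matrix $M$ is i-adjacent to $C(r)$. (c) If in addition $M$ is very-well-partitioned, then for every monic polynomial $r\in\mathbb{F}[t]$ with degree $n$ such that $N(r)=\pm\det M$, the matrix $M$ is i-adjacent to $C(r)$.
   Context: For a monic polynomial $p(t)=t^n-\sum_{k=0}^{n-1}a_kt^k\in\mathbb{F}[t]$ of degree $n\ge 1$, its norm is $N(p):=(-1)^{n-1}a_0$ (that is, $(-1)^np(0)$), and $C(p)\in\mathrm{M}_n(\mathbb{F})$ is its companion matrix: the matrix with entries $1$ at positions $(j+1,j)$ for $1\le j\le n-1$, last column $(a_0,a_1,\dots,a_{n-1})^T$, and all other entries $0$ (its characteristic polynomial is $p$). $\oplus$ denotes block-diagonal sum. A square matrix $M$ is well-partitioned if there are positive integers $r,s$ and monic (nonconstant) polynomials $p_1,\dots,p_r,q_1,\dots,q_s$ in $\mathbb{F}[t]$ such that: (i) $M=C(p_1)\oplus\cdots\oplus C(p_r)\oplus C(q_1)\oplus\cdots\oplus C(q_s)$ (equality, not just similarity); (ii) $\deg p_i\geq 2$ for all $i\in\{2,\dots,r\}$; (iii) $\deg q_j\geq 2$ for all $j\in\{1,\dots,s-1\}$;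 (iv) each $p_i$ is coprime to each $q_j$. If in addition at most one of $p_1$ and $q_s$ has degree $1$, $M$ is very-well-partitioned. For $A,B\in\mathrm{GL}_n(\mathbb{F})$: $A$ is i-adjacent to $B$ if there is $S\in\mathrm{GL}_n(\mathbb{F})$ with $S^2=I_n$ such that $SA$ is similar to $B$; $A$ is u-adjacent to $B$ if there is $U\in\mathrm{GL}_n(\mathbb{F})$ with $(U-I_n)^2=0$ such that $UA$ is similar to $B$. *)

(* Defs.v *)
From mathcomp Require Import all_boot all_order all_algebra.

Set Implicit Arguments.
Unset Strict Implicit.
Unset Printing Implicit Defensive.

Import GRing.Theory.
Local Open Scope ring_scope.

(* Only meaningful for p != 0: here deg 0 = 0. *)
Definition deg (F : fieldType) (p : {poly F}) : nat := (size p).-1.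

(* For p = t^n - \sum_(k < n) a_k t^k we have a_k = - p`_k.  The library's
   companionmx has the a_k in its last row and its 1s above the diagonal; the
   transpose puts the a_k in the last column and the 1s below the diagonal. *)
Definition companion (F : fieldType) (p : {poly F}) : 'M[F]_(deg p) :=
  (companionmx p)^T.

Definition pnorm (F : fieldType) (p : {poly F}) : F :=
  (-1) ^+ deg p * p.[0].

Definition companion_sum (F : fieldType) (s : seq {poly F}) :
    'M[F]_(\sum_(i < size s) deg s`_i) :=
  \mxdiag_(i < size s) companion s`_i.

(* Indices start at 0: p_1, ..., p_r are ps`_0, ..., ps`_(r - 1), and q_s is
   qs`_(size qs).-1.  The cast identifies n with the sum of the degrees. *)
Record well_partition (F : fieldType) (n : nat) (M : 'M[F]_n)
    (ps qs : seq {poly F}) : Prop := WellPartition {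
  wp_ps_nonempty : (0 < size ps)%N;
  wp_qs_nonempty : (0 < size qs)%N;
  wp_monic : forall p, p \in ps ++ qs -> p \is monic;
  wp_nonconstant : forall p, p \in ps ++ qs -> (0 < deg p)%N;
  wp_eq : exists e : (\sum_(i < size (ps ++ qs)) deg (ps ++ qs)`_i)%N = n,
    M = castmx (e, e) (companion_sum (ps ++ qs));
  wp_deg_ps : forall i, (0 < i < size ps)%N -> (2 <= deg ps`_i)%N;
  wp_deg_qs : forall j, (j < (size qs).-1)%N -> (2 <= deg qs`_j)%N;
  wp_coprime : forall p q, p \in ps -> q \in qs -> coprimep p q
}.

Definition well_partitioned (F : fieldType) (n : nat) (M : 'M[F]_n) : Prop :=
  exists ps qs : seq {poly F}, well_partition M ps qs.

Definition very_well_partitioned (F : fieldType) (n : nat) (M : 'M[F]_n) :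
    Prop :=
  exists ps qs : seq {poly F}, well_partition M ps qs /\
    ~ (deg ps`_0 = 1%N /\ deg qs`_(size qs).-1 = 1%N).

Definition i_adjacent (F : fieldType) (n : nat) (A B : 'M[F]_n) : Prop :=
  exists S : 'M[F]_n, [/\ S \in unitmx, S *m S = 1%:M &
    similar_in unitmx (S *m A) B].

Definition u_adjacent (F : fieldType) (n : nat) (A B : 'M[F]_n) : Prop :=
  exists U : 'M[F]_n, [/\ U \in unitmx, (U - 1%:M) *m (U - 1%:M) = 0 &
    similar_in unitmx (U *m A) B].

(* Main.v *)
Require Import Defs.
From mathcomp Require Import all_boot all_order all_algebra.
From mathcomp Require Import ring.

Set Implicit Arguments.
Unset Strict Implicit.
Unset Printing Implicit Defensive.

Import GRing.Theory.
Local Open Scope ring_scope.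

(** Both kinds of factors are treated at once: with y = 1 the equation
    S^2 = (1 + y) S - y says (S - 1)^2 = 0, and with y = -1 it says S^2 = 1.
    The eigenvalues of such an S are among 1 and y.

    Let M = A (+) B, where A carries the blocks C(p_i) and B the blocks C(q_j).
    The characteristic polynomials of A and B are coprime, so a Sylvester
    equation (sylvester_onto) is solvable and M is similar to the block matrix
    W = [A, X; 0, B] for every X (similar_block_mx). Fix solutions S_A and S_B
    of the quadratic equation, a row w with w S_A = w and a column g with
    S_B g = y g. Then S = [S_A, 0; g w, S_B] solves the same equation, and S W
    has left blocks S_A A and g w A, so that the two halves are linked by a
    rank one block. Writing A' = S_A A, B' = S_B B and Z = S_A X, Schur
    complements give (char_poly_link, transfer_link)
      chi(S W) = chi(A') chi(B') - t (w adj(t - A') Z adj(t - B') g),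
      v adj(t - S W) f
        = (v adj(t - B') g) (t (w adj(t - A') f) - chi(A') (w f)),
    where f lives on the A side and v on the B side.

    If w adj(t - A') f and v adj(t - B') g are coprime to the characteristic
    polynomials of A' and B', then w adj(t - A') x reaches every polynomial of
    degree less than the size of A' when the constant column x varies, and
    similarly on the B side (transfer_onto). So the correction in the first
    formula reaches every polynomial t h with deg h < n - 1, and chi(S W) can be
    any monic polynomial of degree n with the correct constant coefficient.
    Finally, a matrix T for which some v adj(t - T) f is coprime to chi(T) is
    cyclic, hence similar to the companion matrix of chi(T)
    (similar_companion_tr): if m(T) f = 0 then chi(T) divides
    m (v adj(t - T) f), hence m.

    The polynomials w adj(t - A') f are kept under control by making them, and
    the second factors above, nonzero monomials c t^k: these are stable under
    the product formula and coprime to chi(T) as soon as T is invertible. A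
    single block C(p) with S diagonal, f = e_1 and w the last coordinate form
    gives a nonzero constant, by the Hessenberg shape. Longer lists of blocks
    are handled by linking them one at a time with the same S (chainable_cat).
    A block which is linked on both sides needs w f = 0, which is where degree
    at least 2 is required.

    The determinant of S is a power of y. The eigenvalue of S is forced to be 1
    at the end of a block linked to a later one, and y at the start of a block
    linked to an earlier one. Every other diagonal entry may be 1 or y. In
    particular the first entry of the first block is free if deg p_1 >= 2, and
    the last entry of the last block is free if deg q_s >= 2: then both signs
    of the determinant are available, which gives (c). *)

(** * Adjugates *)

(** Expand the bordered matrix [H, f; w, 1] in two ways: by clearing w with
    column operations, and by clearing f with the adjugate of H. *)
Lemma det_sub_rank1 (R : idomainType) n (H : 'M[R]_n) (f : 'cV[R]_n)
    (w : 'rV[R]_n) :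
  \det H != 0 -> \det (H - f *m w) = \det H - (w *m \adj H *m f) 0 0.
Proof.
move=> H_neq0; pose B := block_mx H f w (1%:M : 'M_1).
have detB : \det B = \det (H - f *m w).
  have -> : \det B = \det (B *m block_mx 1%:M 0 (- w) 1%:M).
    by rewrite det_mulmx det_lblock !det1 !mulr1.
  by rewrite mulmx_block !mulmx1 !mul1mx !mulmx0 !mulmxN add0r subrr add0r
    det_ublock det1 mulr1.
apply: (mulfI H_neq0); rewrite -detB mulrC.
transitivity (\det (B *m block_mx 1%:M (- (\adj H *m f)) 0 (\det H)%:M)).
  by rewrite det_mulmx det_ublock det1 mul1r det_scalar1.
rewrite mulmx_block !mulmx1 !mulmx0 !addr0 !mulmxN mulmxA mul_mx_adj.
rewrite !mul_scalar_mx mul_mx_scalar addNr det_lblock scale1r.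
rewrite [- _ + _]mx11_scalar det_scalar1 mulmxA; congr (_ * _).
by move: (_ *m f) => c; rewrite !mxE addrC.
Qed.

Lemma adj_unique (R : idomainType) n (H K : 'M[R]_n) :
  \det H != 0 -> H *m K = (\det H)%:M -> \adj H = K.
Proof.
move=> H_neq0 HK; apply/matrixP => i j; apply: (mulfI H_neq0).
have := congr1 (mulmx (\adj H)) HK.
rewrite mulmxA mul_adj_mx mul_scalar_mx mul_mx_scalar.
by move/matrixP/(_ i j); rewrite !mxE.
Qed.

Lemma adj_ublock (R : idomainType) a b (P : 'M[R]_a) (Z : 'M[R]_(a, b))
    (Q : 'M[R]_b) : \det P != 0 -> \det Q != 0 ->
  \adj (block_mx P Z 0 Q) =
  block_mx (\det Q *: \adj P) (- (\adj P *m Z *m \adj Q)) 0 (\det P *: \adj Q).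
Proof.
move=> P_neq0 Q_neq0.
apply: adj_unique; first by rewrite det_ublock mulf_neq0.
rewrite mulmx_block !mulmx0 !mul0mx !addr0 !add0r mulmxN !mulmxA.
rewrite -!scalemxAr !mul_mx_adj mul_scalar_mx -scalemxAl addNr det_ublock.
by rewrite !scale_scalar_mx [in X in block_mx X]mulrC -scalar_mx_block.
Qed.

Section WellPartitioned.

Variable F : fieldType.

Local Notation "A ^%P" := (map_mx (@polyC F) A) (at level 2, format "A ^%P").
Local Notation CX := char_poly_mx.

(** * Transfer polynomials and cyclic matrices *)

(** The numerator of the transfer function w (t - T)^-1 f, whose denominator is
    the characteristic polynomial of T. *)
Definition transfer n (w : 'rV[F]_n) (T : 'M[F]_n) (f : 'cV[F]_n) : {poly F} :=
  (w^%P *m \adj (CX T) *m f^%P) 0 0.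

Lemma char_poly_neq0 n (T : 'M[F]_n) : char_poly T != 0.
Proof. exact: monic_neq0 (char_poly_monic T). Qed.

Lemma char_poly_tr n (T : 'M[F]_n) : char_poly T^T = char_poly T.
Proof.
rewrite /char_poly -det_tr; congr (\det _).
by rewrite /char_poly_mx linearB /= tr_scalar_mx map_trmx trmxK.
Qed.

Lemma transfer_tr n (w : 'rV[F]_n) T (f : 'cV[F]_n) :
  transfer f^T T^T w^T = transfer w T f.
Proof.
have CXT : CX T^T = (CX T)^T.
  by rewrite /char_poly_mx linearB /= tr_scalar_mx -map_trmx.
by rewrite /transfer CXT -trmx_adj -!map_trmx -!trmx_mul mulmxA mxE.
Qed.

Lemma size_det_le n (H : 'M[{poly F}]_n) :
  (forall i j, size (H i j) <= 2)%N -> (size (\det H) <= n.+1)%N.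
Proof.
move=> szH; apply: (leq_trans (size_sum _ _ _)); apply/bigmax_leqP => s _.
rewrite size_Msign (leq_trans (size_prod_leq _ _)) //.
rewrite leq_subLR addnS ltnS card_ord.
by rewrite addnn -muln2 -[n in (n * 2)%N]card_ord -sum_nat_const leq_sum.
Qed.

Lemma size_adj_char_poly_mx n (T : 'M[F]_n) i j :
  (size ((\adj (CX T)) i j) <= n)%N.
Proof.
case: n T i j => [|n] T i j; first by case: i.
rewrite mxE /cofactor size_Msign size_det_le // => k l.
rewrite !mxE (leq_trans (size_polyD _ _)) // geq_max size_polyN size_polyC.
rewrite (leq_trans (leq_b1 _)) // andbT.
by case: eqP => _; rewrite ?mulr1n ?mulr0n ?size_polyX ?size_poly0.
Qed.

Lemma size_transfer n (w : 'rV[F]_n) T (f : 'cV[F]_n) :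
  (size (transfer w T f) <= n)%N.
Proof.
rewrite /transfer mxE (leq_trans (size_sum _ _ _)) //; apply/bigmax_leqP=> i _.
rewrite mxE mxE mulrC mul_polyC (leq_trans (size_scale_leq _ _)) //.
rewrite (leq_trans (size_sum _ _ _)) //; apply/bigmax_leqP=> j _.
by rewrite mxE mul_polyC (leq_trans (size_scale_leq _ _)) ?size_adj_char_poly_mx.
Qed.

(** Division of t^j f by t - T, with the remainder T^j f. *)
Lemma krylov_division n (T : 'M[F]_n) (f : 'cV[F]_n) j :
  exists G, 'X^j *: f^%P = CX T *m G + (iter j (mulmx T) f)^%P.
Proof.
elim: j => [|j [G IH]]; first by exists 0; rewrite scale1r mulmx0 add0r.
exists ('X *: G + (iter j (mulmx T) f)^%P).
rewrite exprS -scalerA IH scalerDr mulmxDr -scalemxAr -addrA; congr (_ + _).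
by rewrite mulmxBl mul_scalar_mx /= map_mxM subrK.
Qed.

(** The remainder is m(T) f; spelling it out as a sum keeps square matrices of
    size 0 in the scope of the lemma. *)
Lemma poly_division n (T : 'M[F]_n) (f : 'cV[F]_n) (m : {poly F}) k :
  (size m <= k)%N ->
  exists G, m *: f^%P =
    CX T *m G + (\sum_(j < k) m`_j *: iter j (mulmx T) f)^%P.
Proof.
move=> le_m_k; have [G GE] := fin_all_exists (fun j : 'I_k => krylov_division T f j).
exists (\sum_(j < k) (m`_j)%:P *: G j).
have mE : m = \sum_(j < k) m`_j *: 'X^j.
  rewrite -poly_def; apply/polyP => j; rewrite coef_poly.
  by case: ltnP => // le_kj; rewrite nth_default // (leq_trans le_m_k).
rewrite mulmx_sumr raddf_sum -big_split /= [in LHS]mE scaler_suml.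
apply: eq_bigr => j _.
by rewrite map_mxZ -scalemxAr -scalerDr -GE scalerA -mul_polyC.
Qed.

Lemma mul_adj_CX n k (T : 'M[F]_n) (G : 'M_(n, k)) :
  \adj (CX T) *m (CX T *m G) = char_poly T *: G.
Proof. by rewrite mulmxA mul_adj_mx mul_scalar_mx. Qed.

(** Multiply the division m f = (t - T) G + m(T) f by w adj(t - T): the first
    term becomes a multiple of the characteristic polynomial. *)
Lemma transfer_krylov_mod n (w : 'rV[F]_n) T (f : 'cV[F]_n) (m : {poly F}) k :
  (size m <= k)%N ->
  char_poly T %| m * transfer w T f
    - transfer w T (\sum_(j < k) m`_j *: iter j (mulmx T) f).
Proof.
move=> /(poly_division T f) [G GE]; set x := \sum_(j < _) _ in GE *.
suff -> : m * transfer w T f - transfer w T x =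
    char_poly T * (w^%P *m G) 0 0 by rewrite dvdp_mulr.
have := congr1 (mulmx (w^%P *m \adj (CX T))) GE.
rewrite mulmxDr -scalemxAr -[in X in _ = X -> _]mulmxA mul_adj_CX -scalemxAr.
move/matrixP/(_ 0 0); rewrite mxE [X in _ = X -> _]mxE [X in X + _]mxE => ->.
by rewrite addrK.
Qed.

Lemma small_dvdp_eq0 n (T : 'M[F]_n) (p : {poly F}) :
  char_poly T %| p -> (size p <= n)%N -> p = 0.
Proof.
move=> dvd_p le_p; apply: contraTeq le_p => /dvdp_leq/(_ dvd_p).
by rewrite size_char_poly -ltnNge.
Qed.

(** Choose u with u (w adj(t - T) f) = 1 modulo the characteristic polynomial
    and take x = (h u)(T) f. Then w adj(t - T) x and h are congruent, and both
    have degree less than n. *)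
Lemma transfer_onto n (w : 'rV[F]_n) T (f : 'cV[F]_n) (h : {poly F}) :
    coprimep (transfer w T f) (char_poly T) -> (size h <= n)%N ->
  exists x, transfer w T x = h.
Proof.
move=> /Bezout_eq1_coprimepP[[u v] /= uv1] le_h_n.
have := transfer_krylov_mod w T f (leqnn (size (h * u))).
set x := \sum_(j < _) _ => dvd_x; exists x; apply/subr0_eq/(@small_dvdp_eq0 _ T).
  have -> : transfer w T x - h = - (h * u * transfer w T f - transfer w T x)
      + - (h * v) * char_poly T.
    by rewrite -[X in _ - X = _]mulr1 -uv1; ring.
  by rewrite dvdp_addl ?dvdp_mulIr // -mulN1r dvdp_mull.
by rewrite (leq_trans (size_polyD _ _)) // size_polyN geq_max size_transfer.
Qed.

Lemma transfer_onto_row n (w : 'rV[F]_n) T (f : 'cV[F]_n) (h : {poly F}) :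
    coprimep (transfer w T f) (char_poly T) -> (size h <= n)%N ->
  exists x, transfer x T f = h.
Proof.
rewrite -transfer_tr -(char_poly_tr T) => /transfer_onto onto /onto[x xE].
by exists x^T; rewrite -transfer_tr trmxK.
Qed.

Lemma transfer_faithful n (T : 'M[F]_n) (v : 'cV[F]_n) :
  (forall w, transfer w T v = 0) -> v = 0.
Proof.
move=> v0; have adjv0 : \adj (CX T) *m v^%P = 0.
  apply/matrixP => i j; rewrite ord1 [RHS]mxE -[RHS](v0 (delta_mx 0 i)).
  by rewrite /transfer map_delta_mx -rowE -row_mul [RHS]mxE.
have := congr1 (mulmx (CX T)) adjv0.
rewrite mulmx0 mulmxA mul_mx_adj mul_scalar_mx => /matrixP v0'.
apply/matrixP => i j; have /eqP := v0' i j.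
by rewrite !mxE mulf_eq0 (negPf (char_poly_neq0 T)) polyC_eq0 => /eqP.
Qed.

(** The transfer polynomial of chi(T) f against any row is a multiple of chi(T)
    of degree less than n, so it vanishes. *)
Lemma krylov_Cayley_Hamilton n (T : 'M[F]_n) (f : 'cV[F]_n) :
  \sum_(j < n.+1) (char_poly T)`_j *: iter j (mulmx T) f = 0.
Proof.
apply: (@transfer_faithful n T) => w.
apply: (@small_dvdp_eq0 _ T _ _ (size_transfer _ _ _)).
have := transfer_krylov_mod w T f (eq_leq (size_char_poly T)).
by rewrite dvdp_addr ?dvdp_mulIl // dvdpNr.
Qed.

(** The vectors f, T f, ..., T^(n-1) f form a basis: if m(T) f = 0 with
    deg m < n, then chi(T) divides m times the transfer polynomial, hence m. In
    this basis the matrix of T is the companion matrix of chi(T). *)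
Lemma similar_companion_tr (r : {poly F}) (T : 'M[F]_(deg r)) w f :
    coprimep (transfer w T f) (char_poly T) -> char_poly T = r ->
  exists2 K, K \in unitmx & T *m K = K *m companion r.
Proof.
move=> copT chiT.
pose K : 'M[F]_(deg r) := \matrix_(i, j) (iter j (mulmx T) f) i 0.
have colK j : col j K = iter j (mulmx T) f.
  by apply/colP => i; rewrite !mxE.
exists K.
  rewrite -unitmx_tr unitmxE unitfE; apply/det0P => -[v v_neq0 vK].
  pose m := rVpoly v; have le_m : (size m <= deg r)%N by apply: size_poly.
  have := transfer_krylov_mod w T f le_m.
  rewrite (_ : \sum_(j < _) _ = 0); last first.
    apply: trmx_inj; rewrite trmx0 -vK; apply/rowP => i; rewrite !mxE summxE.
    by apply: eq_bigr => j _; rewrite !mxE coef_rVpoly_ord.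
  have -> : transfer w T 0 = 0 by rewrite /transfer map_mx0 mulmx0 mxE.
  rewrite subr0 Gauss_dvdpl 1?coprimep_sym // => /small_dvdp_eq0/(_ le_m) m0.
  by case/negP: v_neq0; rewrite -[v]rVpolyK -/m m0 linear0.
apply/matrixP => i j.
have -> : (T *m K) i j = (iter j.+1 (mulmx T) f) i 0.
  by rewrite /= -colK colE mulmxA -colE [RHS]mxE.
have n_gt0 : (0 < deg r)%N by apply: leq_trans (ltn_ord j).
rewrite [RHS]mxE; have [jE|jn] := eqVneq (j : nat) (deg r).-1.
  have monr : r \is monic by rewrite -chiT char_poly_monic.
  have CH : iter (deg r) (mulmx T) f
      = - (\sum_(k < deg r) r`_k *: iter k (mulmx T) f).
    apply/eqP; rewrite -addr_eq0 addrC -[X in _ + X]scale1r -(monicP monr).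
    by have := krylov_Cayley_Hamilton T f; rewrite chiT big_ord_recr => ->.
  rewrite jE prednK // CH mxE summxE -sumrN; apply: eq_bigr => k _.
  by rewrite !mxE jE eqxx mulrN mulrC.
have lt_j : (j.+1 < deg r)%N.
  by rewrite -ltn_predRL ltn_neqAle jn -ltnS (prednK n_gt0) ltn_ord.
have comp k : companion r k j = (j.+1 == k :> nat)%:R.
  by rewrite !mxE (negPf jn).
rewrite (bigD1 (Ordinal lt_j)) //= comp eqxx mulr1 big1 ?addr0 => [|k].
  by rewrite [RHS]mxE.
by rewrite -val_eqE comp eq_sym => /negPf->; rewrite mulr0.
Qed.

(** * Linking two matrices *)

(** The correction term, up to the factor t, that the blocks Z and f w bring to
    the characteristic polynomial of the linked matrix. *)
Definition coupling a b (w : 'rV[F]_a) (A : 'M[F]_a)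
    (Z : 'M[F]_(a, b)) (B : 'M[F]_b)
    (f : 'cV[F]_b) : {poly F} :=
  (w^%P *m \adj (CX A) *m Z^%P *m \adj (CX B) *m f^%P) 0 0.

(** The shape taken by S W when S = [S_A, 0; f w, S_B], w S_A = w and
    W = [S_A^-1 A, X; 0, S_B^-1 B] (see mul_link). *)
Definition link a b (w : 'rV[F]_a) (A : 'M[F]_a)
    (Z : 'M[F]_(a, b)) (B : 'M[F]_b)
    (f : 'cV[F]_b) : 'M[F]_(a + b) :=
  block_mx 1%:M 0 (f *m w) 1%:M *m block_mx A Z 0 B.

Section Link.

Variables (a b : nat) (w : 'rV[F]_a) (A : 'M[F]_a)
    (Z : 'M[F]_(a, b)) (B : 'M[F]_b)
    (f : 'cV[F]_b).

Let T := link w A Z B f.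

(** Taking the unipotent factor L = [1, 0; f w, 1] out on the left leaves
    t L^-1 - [A, Z; 0, B], where f w occurs only with the factor t. *)
Lemma char_poly_mx_link :
  CX T = block_mx 1%:M 0 (f^%P *m w^%P) 1%:M
    *m block_mx (CX A) (- Z^%P) (- ('X *: f^%P *m w^%P)) (CX B).
Proof.
rewrite /T /link !mulmx_block !mul1mx !mul0mx ?mulmx0 !addr0.
rewrite /char_poly_mx map_block_mx scalar_mx_block opp_block_mx add_block_mx.
rewrite !map_mxD !map_mxM add0r -scalemxAl.
congr block_mx; rewrite ?add0r //.
  by rewrite mulmxBr mul_mx_scalar addrAC subrr add0r.
by rewrite mulmxN opprD addrCA.
Qed.

(** The second factor of char_poly_mx_link is a rank one perturbation of a block
    triangular matrix. *)
Lemma char_poly_link :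
  char_poly T = char_poly A * char_poly B - 'X * coupling w A Z B f.
Proof.
rewrite {1}/char_poly char_poly_mx_link det_mulmx det_lblock !det1 !mul1r.
pose H0 := block_mx (CX A) (- Z^%P) 0 (CX B).
pose f0 : 'cV_(a + b) := col_mx 0 ('X *: f^%P).
pose w0 : 'rV_(a + b) := row_mx w^%P 0.
have detH0 : \det H0 = char_poly A * char_poly B by rewrite det_ublock.
have -> : block_mx (CX A) (- Z^%P) (- ('X *: f^%P *m w^%P)) (CX B) = H0 - f0 *m w0.
  rewrite mul_col_row !mul0mx mulmx0 opp_block_mx add_block_mx.
  by rewrite !oppr0 !addr0 add0r.
rewrite det_sub_rank1 detH0 ?mulf_neq0 ?char_poly_neq0 //; congr (_ - _).
rewrite adj_ublock ?char_poly_neq0 // mul_row_block mul_row_col.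
rewrite mulmx0 !mul0mx !addr0 add0r -scalemxAr mxE; congr ('X * _).
by rewrite !(mulmxN, mulNmx) opprK !mulmxA.
Qed.

(** Solve (t - T) Y = chi(T) (u, 0) by blocks. The lower half of Y is a multiple
    s / chi(B) of adj(t - B) f, where s is the scalar by which the upper half
    enters the lower equation; eliminating the upper half determines s. *)
Lemma transfer_link (u : 'cV[F]_a) (v : 'rV[F]_b) :
  transfer (row_mx 0 v) T (col_mx u 0) =
  transfer v B f * ('X * transfer w A u - char_poly A * ((w *m u) 0 0)%:P).
Proof.
pose Y := \adj (CX T) *m (col_mx u 0)^%P.
have transferE : transfer (row_mx 0 v) T (col_mx u 0) = (v^%P *m dsubmx Y) 0 0.
  rewrite /transfer -mulmxA -/Y -[Y in LHS]vsubmxK map_row_mx map_mx0.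
  by rewrite mul_row_col mul0mx add0r.
set Y1 := usubmx Y; set Y2 := dsubmx Y in transferE *.
pose s := 'X * (w^%P *m Y1) 0 0 - char_poly T * ((w *m u) 0 0)%:P.
have [eq1 eq2] : CX A *m Y1 - Z^%P *m Y2 = char_poly T *: u^%P /\
    CX B *m Y2 = s *: f^%P.
  have : CX T *m Y = char_poly T *: (col_mx u 0)^%P.
    by rewrite mulmxA mul_mx_adj mul_scalar_mx.
  move/(congr1 (mulmx (block_mx 1%:M 0 (- (f^%P *m w^%P)) 1%:M))).
  have LL : block_mx 1%:M 0 (- (f^%P *m w^%P)) 1%:M
      *m block_mx 1%:M 0 (f^%P *m w^%P) 1%:M = 1%:M :> 'M_(a + b).
    rewrite mulmx_block !mul1mx !mul0mx !mulmx0 !mulmx1 !addr0 add0r addNr.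
    by rewrite -scalar_mx_block.
  rewrite char_poly_mx_link (mulmxA _ _ Y) (mulmxA (block_mx _ _ _ _)) LL mul1mx.
  rewrite -[Y]vsubmxK -/Y1 -/Y2 map_col_mx map_mx0 -scalemxAr.
  rewrite !mul_block_col !mulmx0 !addr0 mul1mx scale_col_mx.
  case/eq_col_mx=> eq1 eq2; split; first by rewrite -eq1 mulNmx.
  move: eq2; rewrite mulNmx => /(canRL (addKr _)) ->; rewrite opprK.
  rewrite /s scalerBl -!scalemxAl; congr (_ + _).
    by rewrite -mulmxA [w^%P *m Y1]mx11_scalar mul_mx_scalar scalerA !mxE.
  rewrite mulNmx scalerN -mulmxA -map_mxM [w *m u]mx11_scalar.
  by rewrite map_scalar_mx mul_mx_scalar scalerA !mxE.
pose k := coupling w A Z B f.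
have scale00 (p : {poly F}) (M : 'M_1) : (p *: M) 0 0 = p * M 0 0 by rewrite mxE.
have add00 (M N : 'M[{poly F}]_1) : (M + N) 0 0 = M 0 0 + N 0 0 by rewrite mxE.
have eqB : char_poly B *: Y2 = s *: (\adj (CX B) *m f^%P).
  by rewrite scalemxAr -eq2 mul_adj_CX.
have eqA : char_poly A *: Y1 =
    char_poly T *: (\adj (CX A) *m u^%P) + \adj (CX A) *m Z^%P *m Y2.
  by rewrite scalemxAr -eq1 mulmxBr mul_adj_CX mulmxA subrK.
have sA : char_poly A * s = char_poly T *
    ('X * transfer w A u - char_poly A * ((w *m u) 0 0)%:P)
    + 'X * (w^%P *m \adj (CX A) *m Z^%P *m Y2) 0 0.
  have := congr1 (fun Y => (w^%P *m Y) 0 0) eqA.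
  rewrite mulmxDr -!scalemxAr add00 !scale00 /s.
  rewrite !mulmxA -/(transfer w A u) => wE.
  rewrite mulrBr mulrCA wE; ring.
have sk : char_poly B * (w^%P *m \adj (CX A) *m Z^%P *m Y2) 0 0 = s * k.
  have := congr1 (fun Y => (w^%P *m \adj (CX A) *m Z^%P *m Y) 0 0) eqB.
  by rewrite -!scalemxAr !scale00 !mulmxA.
have sE : s = char_poly B * ('X * transfer w A u - char_poly A * ((w *m u) 0 0)%:P).
  apply: (mulfI (char_poly_neq0 T)).
  rewrite {1}char_poly_link mulrBl -/k.
  have -> : char_poly A * char_poly B * s = char_poly B * (char_poly A * s) by ring.
  rewrite sA mulrDr [_ * ('X * _)]mulrCA sk; ring.
apply: (mulfI (char_poly_neq0 B)); rewrite transferE.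
have -> : char_poly B * (v^%P *m Y2) 0 0 = s * transfer v B f.
  have := congr1 (fun Y => (v^%P *m Y) 0 0) eqB.
  by rewrite -!scalemxAr !scale00 !mulmxA.
by rewrite sE; ring.
Qed.

End Link.

(** * Prescribing the coupling *)

Lemma couplingD a b (w : 'rV[F]_a) A (Z1 Z2 : 'M_(a, b)) B (f : 'cV[F]_b) :
  coupling w A (Z1 + Z2) B f = coupling w A Z1 B f + coupling w A Z2 B f.
Proof. by rewrite /coupling map_mxD mulmxDr !mulmxDl mxE. Qed.

Lemma coupling_rank1 a b (w : 'rV[F]_a) A x (y : 'rV[F]_b) B (f : 'cV[F]_b) :
  coupling w A (x *m y) B f = transfer w A x * transfer y B f.
Proof.
rewrite /coupling /transfer map_mxM !mulmxA -mulmxA -(mulmxA _ y^%P) (mulmxA y^%P).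
by rewrite [RHS]mulrC [y^%P *m _ *m _]mx11_scalar mul_mx_scalar !mxE.
Qed.

(** Rank one matrices Z give products of a polynomial of degree < a and one of
    degree < b. Write g = t^(b-1) g1 + g0 with deg g1 < a and deg g0 < b - 1:
    two rank one terms are enough. *)
Lemma coupling_onto a b (w : 'rV[F]_a) A (u : 'cV[F]_a) (v : 'rV[F]_b) B
    (f : 'cV[F]_b) (g : {poly F}) :
    coprimep (transfer w A u) (char_poly A) ->
    coprimep (transfer v B f) (char_poly B) ->
    (0 < a)%N -> (0 < b)%N -> (size g <= (a + b).-1)%N ->
  exists Z, coupling w A Z B f = g.
Proof.
move=> copA copB a_gt0 b_gt0 le_g.
have [|x1 x1E] := transfer_onto (h := 1) copA; first by rewrite size_poly1.
have [|x2 x2E] := transfer_onto (h := drop_poly b.-1 g) copA.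
  rewrite size_drop_poly leq_subLR (leq_trans le_g) // leq_eqVlt.
  by case: (b) b_gt0 => // b' _; rewrite addnC eqxx.
have [|y1 y1E] := transfer_onto_row (h := take_poly b.-1 g) copB.
  by rewrite (leq_trans (size_take_poly _ _)) ?leq_pred.
have [|y2 y2E] := transfer_onto_row (h := 'X^(b.-1)) copB.
  by rewrite size_polyXn prednK.
exists (x1 *m y1 + x2 *m y2).
by rewrite couplingD !coupling_rank1 x1E x2E y1E y2E mul1r poly_take_drop.
Qed.

(** The matrix R is the upper right block of p evaluated at [A, X; 0, B], and
    the identity says that this evaluation commutes with its argument. *)
Lemma sylvester_poly a b (A : 'M[F]_a.+1) (B : 'M[F]_b.+1)
    (X : 'M[F]_(a.+1, b.+1)) p :
  exists R, A *m R - R *m B = horner_mx A p *m X - X *m horner_mx B p.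
Proof.
elim/poly_ind: p => [|p c [R RE]].
  by exists 0; rewrite !rmorph0 !mulmx0 !mul0mx.
exists (R *m B + horner_mx A p *m X).
have hE k (T : 'M[F]_k.+1) : horner_mx T (p * 'X + c%:P) = horner_mx T p *m T + c%:M.
  by rewrite rmorphD rmorphM /= horner_mx_X horner_mx_C.
have commA : A *m horner_mx A p = horner_mx A p *m A.
  by rewrite -{1 4}(horner_mx_X A) !mulmxE -!rmorphM mulrC.
rewrite !hE !mulmxDl !mulmxDr mul_scalar_mx mul_mx_scalar.
rewrite [in RHS]opprD [RHS]addrACA subrr addr0.
rewrite opprD addrACA !mulmxA -mulmxBl RE mulmxBl commA.
by rewrite [LHS]addrC addrA subrK.
Qed.

(** Apply sylvester_poly to a polynomial which vanishes at A and takes the value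
    1 at B; Bezout provides it. *)
Lemma sylvester_onto a b (A : 'M[F]_a) (B : 'M[F]_b) (X : 'M[F]_(a, b)) :
  coprimep (char_poly A) (char_poly B) -> exists Y, A *m Y - Y *m B = X.
Proof.
case: a b A B X => [|a] [|b] A B X;
  try by exists 0; rewrite ?[X]flatmx0 ?[X]thinmx0 ?[LHS]flatmx0 ?[LHS]thinmx0.
move=> /Bezout_eq1_coprimepP[[u v] /= uv1].
have [R RE] := sylvester_poly A B X (u * char_poly A).
exists (- R); rewrite mulmxN mulNmx -opprD RE.
have -> : horner_mx A (u * char_poly A) = 0.
  by rewrite rmorphM /= Cayley_Hamilton mulr0.
have -> : horner_mx B (u * char_poly A) = 1.
  rewrite -[u * _](addrK (v * char_poly B)) uv1 rmorphB rmorph1 rmorphM /=.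
  by rewrite Cayley_Hamilton mulr0 subr0.
by rewrite mul0mx mulmx1 sub0r opprK.
Qed.

(** Nonzero monomials are closed under products and, for T invertible, coprime
    to the characteristic polynomial of T. *)
Definition is_monomial (p : {poly F}) := exists c k, c != 0 /\ p = c *: 'X^k.

Lemma monomialM p q : is_monomial p -> is_monomial q -> is_monomial (p * q).
Proof.
move=> [c [k [c0 ->]]] [d [l [d0 ->]]]; exists (c * d), (k + l)%N.
by rewrite mulf_neq0 // -scalerAl -scalerAr scalerA exprD.
Qed.

Lemma monomialX : is_monomial 'X.
Proof. by exists 1, 1%N; rewrite oner_eq0 scale1r expr1. Qed.

Lemma monomialC c : c != 0 -> is_monomial c%:P.
Proof. by move=> c0; exists c, 0%N; rewrite c0 expr0 alg_polyC. Qed.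

Lemma monomial_coprime p n (T : 'M[F]_n) :
  is_monomial p -> T \in unitmx -> coprimep p (char_poly T).
Proof.
move=> [c [k [c0 ->]]] unitT; rewrite coprimepZl //.
rewrite coprimep_expl // coprimep_sym coprimepX rootE horner_coef0.
rewrite char_poly_det mulf_neq0 //.
  by rewrite signr_eq0.
by rewrite -unitfE -unitmxE.
Qed.

(** * Matrices that can be linked end to end *)

(** The last two fields control the factors that transfer_link attaches to a
    matrix, according to whether it stands below or above the link. *)
Record chain (y : F) n (A S : 'M[F]_n) (w : 'rV[F]_n) (f : 'cV[F]_n) : Prop := Chain {
  chain_quad : S *m S = (1 + y) *: S - y%:M;
  chain_transfer : is_monomial (transfer w (S *m A) f);
  chain_next : is_monomial ('X * transfer w (S *m A) f
    - char_poly (S *m A) * ((w *m f) 0 0)%:P) }.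

Lemma mul_link a b (S A : 'M[F]_a) (X : 'M_(a, b)) (w : 'rV[F]_a) (f : 'cV[F]_b)
    (S' B : 'M[F]_b) :
  w *m S = w ->
  block_mx S 0 (f *m w) S' *m block_mx A X 0 B
  = link w (S *m A) (S *m X) (S' *m B) f.
Proof.
move=> wS; rewrite /link !mulmx_block !mul0mx !mulmx0 !mul1mx !addr0.
by rewrite !mulmxA -(mulmxA f w S) wS.
Qed.

Lemma quad_link y a b (S : 'M[F]_a) (w : 'rV[F]_a) (f : 'cV[F]_b) (S' : 'M[F]_b) :
    S *m S = (1 + y) *: S - y%:M -> S' *m S' = (1 + y) *: S' - y%:M ->
    w *m S = w -> S' *m f = y *: f ->
  let U := block_mx S 0 (f *m w) S' in U *m U = (1 + y) *: U - y%:M.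
Proof.
move=> SS SS' wS Sf /=.
rewrite mulmx_block !mul0mx !mulmx0 !addr0 add0r -mulmxA wS mulmxA Sf SS SS'.
rewrite scale_block_mx scaler0 scalar_mx_block opp_block_mx add_block_mx.
by rewrite !subr0 -scalemxAl -[X in X + y *: _]scale1r -scalerDl.
Qed.

(** The flag r allows a link to a later matrix, the flag l a link to an earlier
    one, and the flag o makes both links compatible with the quadratic
    equation. Since det S is a power of y, only its exponent j is recorded. *)
Definition chainable y n (A : 'M[F]_n) (r l o : bool) j :=
  exists S w f, [/\ chain y A S w f, r -> w *m S = w, l -> S *m f = y *: f,
    o -> w *m f = 0 & \det S = y ^+ j].

(** The link uses the right end of A and the left end of B. The left end of the
    result is that of A, and it survives only if w f = 0 on A: otherwise the new
    block f_B w moves f. Symmetrically for the right end and B. *)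
Lemma chainable_cat y a b (A : 'M[F]_a) (B : 'M[F]_b) l1 o1 r2 o2 i j :
    chainable y A true l1 o1 i -> chainable y B r2 true o2 j ->
  chainable y (block_mx A 0 0 B) (r2 && o2) (l1 && o1) true (i + j).
Proof.
move=> [S [w [f [[SS tr nx] /(_ isT) wS lS oS dS]]]].
move=> [S' [v [g [[SS' tr' nx'] rS' /(_ isT) Sg oS' dS']]]].
have orth : row_mx 0 v *m col_mx f 0 = 0 :> 'M_1.
  by rewrite mul_row_col mul0mx mulmx0 addr0.
exists (block_mx S 0 (g *m w) S'), (row_mx 0 v), (col_mx f 0); split => //.
- have trE : is_monomial (transfer (row_mx 0 v)
     (block_mx S 0 (g *m w) S' *m block_mx A 0 0 B) (col_mx f 0)).
    by rewrite mul_link // transfer_link; apply: monomialM.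
  split=> //; first exact: quad_link.
  by rewrite orth mxE polyC0 mulr0 subr0; apply: monomialM => //; exact: monomialX.
- move=> /andP[/rS' vS' /oS' vg].
  by rewrite mul_row_block mulmxA vg !mul0mx !add0r vS'.
- move=> /andP[/lS Sf /oS wf].
  by rewrite mul_block_col -mulmxA wf !mulmx0 !addr0 Sf scale_col_mx scaler0.
- by rewrite det_lblock dS dS' exprD.
Qed.

Lemma chainableW y n (A : 'M[F]_n) r l o r' l' o' j :
  chainable y A r l o j -> r' ==> r -> l' ==> l -> o' ==> o ->
  chainable y A r' l' o' j.
Proof.
move=> [S [w [f [cS lS rS oS dS]]]] /implyP ll /implyP rr /implyP oo.
by exists S, w, f; split; auto.
Qed.

(** The cofactor obtained by deleting the first row and the last column of t - T
    is triangular, with the opposites of the subdiagonal entries of T on its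
    diagonal. *)
Lemma transfer_hessenberg n (T : 'M[F]_n.+1) :
    (forall i j : 'I_n.+1, (j.+1 < i)%N -> T i j = 0) ->
    (forall i j : 'I_n.+1, (i : nat) = j.+1 -> T i j != 0) ->
  exists2 c, c != 0 & transfer (delta_mx 0 ord_max) T (delta_mx 0 0)^T = c%:P.
Proof.
move=> T0 T1.
exists ((-1) ^+ n * \prod_(i < n) - T (lift ord0 i) (lift ord_max i)).
  rewrite mulf_neq0 ?signr_eq0 //; apply/prodf_neq0 => i _; rewrite oppr_eq0 T1 //.
  by rewrite /= /bump leq0n (leqNgt n) ltn_ord.
rewrite /transfer -map_trmx !map_delta_mx -rowE trmx_delta -colE !mxE /cofactor.
rewrite add0n rmorphM rmorph_sign; congr (_ * _).
rewrite -det_tr det_trig; last first.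
  apply/is_trig_mxP => i j lt_ij; rewrite !mxE.
  rewrite T0; last by rewrite /= /bump leq0n (leqNgt n) ltn_ord.
  rewrite -val_eqE /= /bump leq0n (leqNgt n) ltn_ord /= add0n add1n.
  by rewrite gtn_eqF ?subr0 // ltnS ltnW.
rewrite rmorph_prod; apply: eq_bigr => i _; rewrite !mxE.
rewrite -val_eqE /= /bump leq0n (leqNgt n) ltn_ord /= add0n add1n.
by rewrite gtn_eqF // sub0r rmorphN.
Qed.

(** Take S diagonal with entries y^(e i), which keeps the Hessenberg shape, w the
    last coordinate form and f the first basis vector. *)
Lemma chainable_hessenberg y n (A : 'M[F]_n) (e : nat -> bool) :
    y != 0 -> (0 < n)%N -> A \in unitmx ->
    (forall i j : 'I_n, (j.+1 < i)%N -> A i j = 0) ->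
    (forall i j : 'I_n, (i : nat) = j.+1 -> A i j != 0) ->
  chainable y A (~~ e n.-1) (e 0%N) (1 < n)%N (\sum_(i < n) e i)%N.
Proof.
case: n A => // n A y0 _ unitA A0 A1.
pose D : 'rV[F]_n.+1 := \row_i y ^+ e i; pose S := diag_mx D.
have SAE i j : (S *m A) i j = y ^+ e i * A i j by rewrite mul_diag_mx !mxE.
exists S, (delta_mx 0 ord_max), (delta_mx 0 0)^T.
have [||c c0 trE] := @transfer_hessenberg _ (S *m A).
- by move=> i j lt_ij; rewrite SAE A0 ?mulr0.
- by move=> i j ij; rewrite SAE mulf_neq0 ?expf_neq0 ?A1.
have dotE : ((delta_mx 0 ord_max : 'rV[F]_n.+1) *m
    (delta_mx 0 0 : 'rV_n.+1)^T) = (n == 0%N)%:R%:M.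
  apply/matrixP => i j; rewrite !ord1 -rowE !mxE /= mulr1n.
  by rewrite -val_eqE.
split.
- split.
  + apply/matrixP => i j; rewrite mul_diag_mx !mxE.
    by case: (i == j); case: (e i); rewrite ?mulr1n ?mulr0n ?expr1 ?expr0; ring.
  + by rewrite trE; apply: monomialC.
  + rewrite dotE mxE eqxx mulr1n; case: (eqVneq n 0%N) => [n0|n0].
      (* Here w f = 1, and t - chi(S A) is the entry of the 1 x 1 matrix S A. *)
      subst n; have -> : char_poly (S *m A) = 'X - ((S *m A) 0 0)%:P.
        rewrite /char_poly det_mx11 mxE [X in X + _]mxE [X in _ + X]mxE.
        by rewrite [X in - X]mxE mulr1n.
      have -> : transfer (delta_mx 0 ord_max) (S *m A) (delta_mx 0 0)^T = 1.
        rewrite /transfer -map_trmx !map_delta_mx -rowE trmx_delta -colE.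
        by rewrite mxE mxE mxE /cofactor det_mx00 mulr1.
      rewrite polyC1 !mulr1 subKr; apply: monomialC.
      rewrite SAE mulf_neq0 ?expf_neq0 //.
      by move: unitA; rewrite unitmxE det_mx11 unitfE.
    rewrite polyC0 mulr0 subr0 trE.
    by apply: monomialM; [exact: monomialX|exact: monomialC].
- move=> /negPf /= eN; apply/rowP => j; rewrite mul_mx_diag !mxE /=.
  by have [->|_] := eqVneq j ord_max; rewrite ?mul0r //= eN mulr1.
- move=> e0; apply/colP => j; rewrite mul_diag_mx !mxE.
  by have [->|_] := eqVneq j 0; rewrite ?mulr0 //= e0.
- by rewrite ltnS lt0n dotE => /negPf ->; rewrite raddf0.
- by rewrite det_diag -prodrXr; apply: eq_bigr => i _; rewrite mxE.
Qed.
Lemma chainable_companion (y : F) (p : {poly F}) (e : nat -> bool) :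
    y != 0 -> (0 < deg p)%N -> companion p \in unitmx ->
  chainable y (companion p) (~~ e (deg p).-1) (e 0%N) (1 < deg p)%N
    (\sum_(i < deg p) e i)%N.
Proof.
move=> y0 p_gt0 unitC; apply: chainable_hessenberg => // i j ij.
  have jn : (j == (deg p).-1 :> nat) = false.
    by rewrite ltn_eqF // ltn_predRL (leq_trans ij) // ltnW.
  by rewrite !mxE jn ltn_eqF.
have jn : (j == (deg p).-1 :> nat) = false.
  by rewrite ltn_eqF // ltn_predRL -ij.
by rewrite !mxE jn ij eqxx oner_eq0.
Qed.

Lemma chainable_companion1 (y : F) (p : {poly F}) b :
    y != 0 -> deg p = 1%N -> companion p \in unitmx ->
  chainable y (companion p) (~~ b) b false b.
Proof.
move=> y0 p1 unitC; have := chainable_companion (fun=> b) y0 _ unitC.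
rewrite sum_nat_const card_ord (_ : (deg p * b)%N = b); last by rewrite p1 mul1n.
by rewrite (_ : (1 < deg p)%N = false) ?p1 //; apply; rewrite p1.
Qed.

Lemma chainable_companion2 (y : F) (p : {poly F}) b0 b1 :
    y != 0 -> (1 < deg p)%N -> companion p \in unitmx ->
  chainable y (companion p) (~~ b1) b0 true (b0 + b1).
Proof.
move=> y0 p1 unitC.
pose e i := if i == 0%N then b0 else (i == (deg p).-1) && b1.
have p0 : (0 < deg p)%N by apply: ltnW.
have := chainable_companion e y0 p0 unitC.
rewrite p1; have -> : e 0%N = b0 by [].
have eN : e (deg p).-1 = b1.
  by rewrite /e eqxx gtn_eqF // ltn_predRL.
suff -> : (\sum_(i < deg p) e i = b0 + b1)%N by rewrite eN.
rewrite -(big_mkord xpredT (fun i => nat_of_bool (e i))).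
rewrite -(prednK p0) big_nat_recr //= eN big_ltn; last by rewrite ltn_predRL.
rewrite big_nat_cond big1 ?addn0 // => i /andP[/andP[i_gt0 i_lt] _].
by rewrite /e gtn_eqF // ltn_eqF.
Qed.

(** * Lists of companion blocks *)

(** Block diagonal sums whose size is that of the nested block matrix, so that
    induction over the list needs no transport between sizes. *)
Inductive dsum : seq {poly F} -> forall n, 'M[F]_n -> Prop :=
| dsum1 p : dsum [:: p] (companion p)
| dsum_cons p s n (B : 'M_n) :
    dsum s B -> dsum (p :: s) (block_mx (companion p) 0 0 B).

Lemma dsum_cast s n m (A : 'M_n) (e : n = m) :
  dsum s (castmx (e, e) A) <-> dsum s A.
Proof. by case: m / e; rewrite castmx_id. Qed.

(** The iterated sum ends with an empty block, which is absorbed here. *)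
Lemma dsum1_block p m (B : 'M[F]_m) :
  m = 0%N -> dsum [:: p] (block_mx (companion p) 0 0 B).
Proof.
move=> m0; subst m; have e := addn0 (deg p).
apply/(dsum_cast _ _ e); rewrite (_ : castmx _ _ = companion p).
  exact: dsum1.
apply/matrixP => i j; rewrite castmxE.
have lE (k : 'I_(deg p)) : cast_ord (esym e) k = lshift 0 k by apply: val_inj.
by rewrite !lE block_mxEul.
Qed.

Lemma dsum_companion_sum s : s != [::] -> dsum s (companion_sum s).
Proof.
elim: s => // p s IH _; rewrite /companion_sum /= mxdiag_recl.
apply/dsum_cast; case: s IH => [_|q s /(_ isT) IH]; last exact: dsum_cons.
by apply: dsum1_block; rewrite big_ord0.
Qed.

Lemma dsum_cat s1 s2 n (A : 'M_n) : s1 != [::] -> s2 != [::] ->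
    dsum (s1 ++ s2) A ->
  exists a b (B : 'M_a) (C : 'M_b) (e : (a + b)%N = n),
    [/\ dsum s1 B, dsum s2 C & A = castmx (e, e) (block_mx B 0 0 C)].
Proof.
move: {-1}(s1 ++ s2) (erefl (s1 ++ s2)) => s sE s1n s2n dA.
elim: dA s1 s2 s1n s2n sE => {s n A} [p|p s n B dB IH] [|p1 s1] s2 // _ s2n.
  by case=> _; case: s1 s2 s2n => [|? ?] [].
case=> ->; case: s1 => [/= sE|p2 s1 sE].
  by exists (deg p), n, (companion p), B, erefl; rewrite sE; split=> //; exact: dsum1.
have [a [b [B1 [C [e [d1 d2 BE]]]]]] := IH (p2 :: s1) s2 isT s2n sE.
exists (deg p + a)%N, b, (block_mx (companion p) 0 0 B1), C.
subst n; exists (esym (addnA _ _ _)); split=> //; first exact: dsum_cons.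
rewrite BE castmx_id; have := @block_mxA F _ _ _ _ _ _ (companion p) 0 0 0 B1 0 0 0 C.
by rewrite /= !row_mx0 !col_mx0 => ->.
Qed.

Lemma dsum_char_poly s n (A : 'M_n) : dsum s A ->
  (forall p, p \in s -> p \is monic) -> char_poly A = \prod_(p <- s) p.
Proof.
have compK (p : {poly F}) : p \is monic -> char_poly (companion p) = p.
  by move=> monp; rewrite char_poly_tr companionmxK.
elim=> {s n A} [p|p s n B _ IH] mon.
  by rewrite big_seq1 compK // mon ?mem_head.
rewrite /char_poly char_block_diag_mx det_ublock big_cons.
congr (_ * _); first by apply: compK; rewrite mon ?mem_head.
by apply: IH => q qs; rewrite mon // mem_behead.
Qed.

Lemma unit_block a b (A : 'M[F]_a) (B : 'M[F]_b) :
  block_mx A 0 0 B \in unitmx -> A \in unitmx /\ B \in unitmx.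
Proof. by rewrite block_diag_mx_unit => /andP. Qed.

(** Diagonal entry y at the first position of each block and 1 elsewhere. *)
Lemma dsum_chainable (y : F) s n (A : 'M_n) :
    y != 0 -> dsum s A -> A \in unitmx ->
  (forall p, p \in s -> (1 < deg p)%N) -> exists j, chainable y A true true true j.
Proof.
move=> y0; elim=> {s n A} [p|p s n B _ IH] unitA degs.
  exists (true + false)%N; apply: (chainable_companion2 true false) => //.
  by rewrite degs ?mem_head.
have [unitp unitB] := unit_block unitA.
have [|j cB] := IH unitB; first by move=> q qs; rewrite degs // mem_behead.
exists (true + false + j)%N.
apply: (chainable_cat (l1 := true) (o1 := true) (r2 := true)) => //.
by apply: (chainable_companion2 true false); rewrite ?degs ?mem_head.
Qed.

(** Nothing is linked before the first block, so its first diagonal entry may be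
    1 or y unless it is also the last one. *)
Lemma dsum_chainable_left (y : F) s n (A : 'M_n) :
    y != 0 -> dsum s A -> A \in unitmx ->
    (0 < deg s`_0)%N -> (forall p, p \in behead s -> (1 < deg p)%N) ->
  exists j, chainable y A true false false j /\
    ((1 < deg s`_0)%N -> chainable y A true false false j.+1).
Proof.
move=> y0.
have head p b : (0 < deg p)%N -> companion p \in unitmx ->
    b ==> (1 < deg p)%N -> chainable y (companion p) true false false b.
  move=> p0 unitp /implyP p1; have [p2|p2] := ltnP 1 (deg p).
    have := chainable_companion2 b false y0 p2 unitp.
    by rewrite addn0 => /chainableW; apply; rewrite ?implybT.
  have -> : b = false by case: b p1 p2 => // /(_ isT) p1; rewrite leqNgt p1.
  apply: (chainable_companion1 false) => //.
  by apply/eqP; rewrite eqn_leq p2.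
case=> {s n A} [p|p s n B dB] unitA /= p0 degs.
  by exists 0%N; split=> [|p1]; [apply: (head p false) | apply: (head p true)].
have [unitp unitB] := unit_block unitA.
have [j cB] := dsum_chainable y0 dB unitB degs.
exists (false + j)%N; split=> [|p1].
  apply: chainableW (chainable_cat (head p false _ _ _) cB) _ _ _ => //.
rewrite -[_.+1]/(true + j)%N.
by apply: chainableW (chainable_cat (head p true _ _ _) cB) _ _ _.
Qed.

(** Nothing is linked after the last block, so its last diagonal entry may be 1 or
    y unless it is also the first one. *)
Lemma dsum_chainable_right (y : F) s n (A : 'M_n) :
    y != 0 -> dsum s A -> A \in unitmx ->
    (forall p, p \in s -> (0 < deg p)%N) ->
    (forall i, (i < (size s).-1)%N -> (1 < deg s`_i)%N) ->
  exists j, chainable y A false true false j /\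
    ((1 < deg s`_(size s).-1)%N -> chainable y A false true false j.+1).
Proof.
move=> y0; elim=> {s n A} [p|p s n B dB IH] unitA pos degs.
  have p0 : (0 < deg p)%N by rewrite pos ?mem_head.
  exists 1%N => /=; split=> [|p1]; last first.
    exact: chainableW (chainable_companion2 true true y0 p1 unitA) _ _ _.
  have [p2|p2] := ltnP 1 (deg p).
    exact: chainableW (chainable_companion2 true false y0 p2 unitA) _ _ _.
  have {}p2 : deg p = 1%N by apply/eqP; rewrite eqn_leq p2.
  exact: chainableW (chainable_companion1 true y0 p2 unitA) _ _ _.
have [unitp unitB] := unit_block unitA.
have s_gt0 : (0 < size s)%N by case: dB.
have p1 : (1 < deg p)%N by apply: (degs 0%N).
have cp := chainable_companion2 true false y0 p1 unitp.
have [q qs|i i_lt|j [cB cB1]] := IH unitB.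
- by rewrite pos // mem_behead.
- by apply: (degs i.+1); rewrite /= -ltn_predRL.
have lastE : (p :: s)`_(size s) = s`_(size s).-1.
  by rewrite -{1}(prednK s_gt0).
exists j.+1; rewrite [(size _).-1]/= lastE.
split=> [|/cB1 {}cB]; exact: chainableW (chainable_cat cp cB) _ _ _.
Qed.

(** * Products with the two halves linked *)

Lemma size_monic_sub n (p q : {poly F}) : p \is monic -> q \is monic ->
  size p = n.+1 -> size q = n.+1 -> (size (p - q)%R <= n)%N.
Proof.
move=> monp monq szp szq; apply/leq_sizeP => j; rewrite leq_eqVlt coefB.
case/predU1P => [<-|lt_nj]; last by rewrite !nth_default ?subr0 ?szp ?szq.
move/monicP: monp; move/monicP: monq.
by rewrite !lead_coefE szp szq /= => -> ->; rewrite subrr.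
Qed.

(** In size 0 the transfer polynomial is 0, which is not a monomial. *)
Lemma chainable_gt0 (y : F) n (A : 'M[F]_n) r l o j :
  chainable y A r l o j -> (0 < n)%N.
Proof.
move=> [S [w [f [[_ [c [k [c0 trE]]] _] _ _ _ _]]]].
apply: leq_trans (size_transfer w (S *m A) f).
by rewrite trE size_scale // size_polyXn.
Qed.

Lemma similar_companion_cast n (T : 'M[F]_n) w f (r : {poly F}) (e : deg r = n) :
    coprimep (transfer w T f) (char_poly T) -> char_poly T = r ->
  exists2 K, K \in unitmx & T *m K = K *m castmx (e, e) (companion r).
Proof.
case: n / e T w f => T w f; rewrite castmx_id; exact: similar_companion_tr.
Qed.

(** The matrix S does not depend on r; only the block X does. This is what lets a
    single sign serve all polynomials r at once. *)
Lemma chainable_companion_product (y : F) a b (A : 'M[F]_a) (B : 'M[F]_b) i j :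
    y != 0 -> A \in unitmx -> B \in unitmx ->
    chainable y A true false false i -> chainable y B false true false j ->
  exists S : 'M[F]_(a + b), [/\ S *m S = (1 + y) *: S - y%:M, \det S = y ^+ (i + j) &
    forall (r : {poly F}) (e : deg r = (a + b)%N), r \is monic ->
      pnorm r = y ^+ (i + j) * (\det A * \det B) ->
    exists X K, K \in unitmx /\
      S *m block_mx A X 0 B *m K = K *m castmx (e, e) (companion r)].
Proof.
move=> y0 unitA unitB cA cB.
have [a_gt0 b_gt0] := (chainable_gt0 cA, chainable_gt0 cB).
have [S [w [f [[SS tr nx] /(_ isT) wS _ _ dS]]]] := cA.
have [S' [v [g [[SS' tr' nx'] _ /(_ isT) Sg _ dS']]]] := cB.
have detS : \det (block_mx S 0 (g *m w) S') = y ^+ (i + j).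
  by rewrite det_lblock dS dS' exprD.
exists (block_mx S 0 (g *m w) S'); split=> //; first exact: quad_link.
move=> r e monr normr.
have unitS : S \in unitmx by rewrite unitmxE dS unitfE expf_neq0.
have unitS' : S' \in unitmx by rewrite unitmxE dS' unitfE expf_neq0.
have unitSA : S *m A \in unitmx by rewrite unitmx_mul unitS.
have unitSB : S' *m B \in unitmx by rewrite unitmx_mul unitS'.
(* The norm condition says that d vanishes at 0, so that d / t is a polynomial
   of degree less than a + b - 1. *)
pose d := char_poly (S *m A) * char_poly (S' *m B) - r.
have [Z ZE] : exists Z, coupling w (S *m A) Z (S' *m B) g = drop_poly 1 d.
  apply: (coupling_onto (u := f) (v := v)) => //; try exact: monomial_coprime.
  rewrite size_drop_poly -subn1 leq_sub2r // size_monic_sub //.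
  - by rewrite monicMl char_poly_monic.
  - by rewrite size_mul ?char_poly_neq0 // !size_char_poly addnS.
  - by rewrite -e polySpred ?monic_neq0.
pose X := invmx S *m Z; exists X.
have linkE : block_mx S 0 (g *m w) S' *m block_mx A X 0 B
    = link w (S *m A) Z (S' *m B) g.
  by rewrite mul_link // /X mulKVmx.
set T := _ *m _ in linkE *.
have chiT : char_poly T = r.
  rewrite linkE char_poly_link ZE.
  have -> : 'X * drop_poly 1 d = d.
    rewrite -[RHS](poly_take_drop 1) expr1 mulrC -[LHS]add0r; congr (_ + _).
    apply/polyP => k; rewrite coef0 coef_take_poly; case: k => //=.
    rewrite coefB coefM big_ord1 !char_poly_det !det_mulmx dS dS'.
    have r0E : r`_0 = (-1) ^+ (a + b) * pnorm r.
      rewrite /pnorm e mulrA -exprD addnn -signr_odd odd_double mul1r.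
      by rewrite horner_coef0.
    by rewrite r0E normr !exprD; ring.
  by rewrite /d opprB addrC subrK.
have unitT : T \in unitmx.
  by rewrite unitmx_mul !unitmxE detS det_ublock !unitfE expf_neq0 //
    mulf_neq0 // -unitfE -unitmxE.
have copT : coprimep (transfer (row_mx 0 v) T (col_mx f 0)) (char_poly T).
  apply: monomial_coprime unitT; rewrite linkE transfer_link; exact: monomialM.
by have [K unitK KE] := similar_companion_cast e copT chiT; exists K.
Qed.

Lemma similar_block_mx a b (A : 'M[F]_a) (B : 'M[F]_b) X :
  coprimep (char_poly A) (char_poly B) ->
  exists2 P, P \in unitmx & block_mx A 0 0 B *m P = P *m block_mx A X 0 B.
Proof.
move=> /(sylvester_onto X)[Y YE]; exists (block_mx 1%:M Y 0 1%:M).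
  by rewrite unitmxE det_ublock !det1 mulr1 unitr1.
rewrite !mulmx_block !mul1mx !mulmx1 !mul0mx !mulmx0 !addr0 !add0r.
by rewrite -YE subrK.
Qed.

Lemma coprimep_prodr (p : {poly F}) (s : seq {poly F}) :
  (forall q, q \in s -> coprimep p q) -> coprimep p (\prod_(q <- s) q).
Proof.
elim: s => [|q s IH] cops; first by rewrite big_nil coprimep1.
rewrite big_cons coprimepMr cops ?mem_head // IH // => q' q's.
by rewrite cops // mem_behead.
Qed.

(** * Assembling the two halves *)

(** The second exponent exists because one of the two outer ends has a free
    diagonal entry. *)
Lemma quadratic_product (y : F) n (M : 'M[F]_n) ps qs :
    y != 0 -> M \in unitmx -> well_partition M ps qs ->
  exists k, forall k',
    k' = k \/ (k' = k.+1 /\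
      ((1 < deg ps`_0)%N || (1 < deg qs`_(size qs).-1)%N)) ->
  forall (r : {poly F}) (hr : deg r = n), r \is monic ->
    pnorm r = y ^+ k' * \det M ->
  exists S, [/\ S \in unitmx, S *m S = (1 + y) *: S - y%:M
    & similar_in unitmx (S *m M) (castmx (hr, hr) (companion r))].
Proof.
move=> y0 unitM [ps0 qs0 mon pos ME degp degq cop].
have psn : ps != [::] by case: (ps) ps0.
have qsn : qs != [::] by case: (qs) qs0.
have dM : dsum (ps ++ qs) M.
  case: ME => e ->; apply/dsum_cast/dsum_companion_sum.
  by case: (ps) psn.
have [a [b [A [B [eab [dA dB MAB]]]]]] := dsum_cat psn qsn dM.
subst n; rewrite castmx_id in MAB; rewrite {M ME dM}MAB in unitM *.
have [unitA unitB] := unit_block unitM.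
have copAB : coprimep (char_poly A) (char_poly B).
  rewrite (dsum_char_poly dA) => [|p pps]; last by rewrite mon // mem_cat pps.
  rewrite (dsum_char_poly dB) => [|q qqs]; last by rewrite mon // mem_cat qqs orbT.
  apply: coprimep_prodr => q qqs; rewrite coprimep_sym.
  by apply: coprimep_prodr => p pps; rewrite coprimep_sym cop.
have [|p pps|i [cA cA1]] := dsum_chainable_left y0 dA unitA.
- by rewrite pos // mem_cat mem_nth.
- case/(nthP 0): pps => i; rewrite size_behead nth_behead => i_lt <-.
  by apply: degp; rewrite /= -ltn_predRL.
have [p pqs|k k_lt|j [cB cB1]] := dsum_chainable_right y0 dB unitB.
- by rewrite pos // mem_cat pqs orbT.
- exact: degq.
exists (i + j)%N => k' k'E r hr monr normr.
have [i' [j' [cA' cB' k'ij]]] : exists i' j', [/\ chainable y A true false false i',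
    chainable y B false true false j' & k' = (i' + j')%N].
  case: k'E => [->|[-> /orP[/cA1 cA'|/cB1 cB']]]; first by exists i, j.
    by exists i.+1, j.
  by exists i, j.+1; rewrite addnS.
have [S [SS dS SE]] := chainable_companion_product y0 unitA unitB cA' cB'.
have [|X [K [unitK KE]]] := SE r hr monr.
  by rewrite -k'ij normr det_ublock.
have [P unitP PE] := similar_block_mx X copAB.
have unitS : S \in unitmx by rewrite unitmxE dS unitfE expf_neq0.
exists (P *m S *m invmx P); split.
- by rewrite !unitmx_mul unitP unitS unitmx_inv.
- rewrite !mulmxA mulmxKV // -(mulmxA P S S) SS.
  rewrite mulmxBr mulmxBl -scalemxAr -scalemxAl mul_mx_scalar -scalemxAl mulmxV //.
  by rewrite scalemx1.
exists (invmx (P *m K)).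
  by rewrite unitmx_inv unitmx_mul unitP.
have unitPK : P *m K \in unitmx by rewrite unitmx_mul unitP.
apply/similarP; first by rewrite unitmx_inv.
apply: (can_inj (mulmxK unitPK)); rewrite mulmxKV // -(mulmxA (invmx (P *m K))).
apply: (canLR (mulKmx unitPK)); rewrite !mulmxA.
rewrite -(mulmxA _ _ P) PE -(mulmxA P K) -KE.
by rewrite !mulmxA mulmxKV.
Qed.

End WellPartitioned.

Theorem theorem3p6 (F : fieldType) (n : nat) (M : 'M[F]_n)
    (hM : M \in unitmx) (hwp : well_partitioned M) :
  [/\ forall (r : {poly F}) (hr : deg r = n), r \is monic ->
        pnorm r = \det M ->
        u_adjacent M (castmx (hr, hr) (companion r)),
      exists2 eta : F, eta = 1 \/ eta = -1 &
        forall (r : {poly F}) (hr : deg r = n), r \is monic ->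
          pnorm r = eta * \det M ->
          i_adjacent M (castmx (hr, hr) (companion r))
    & very_well_partitioned M ->
        forall (r : {poly F}) (hr : deg r = n), r \is monic ->
          pnorm r = \det M \/ pnorm r = - \det M ->
          i_adjacent M (castmx (hr, hr) (companion r))].
Proof.
have quadN1 (S : 'M[F]_n) : S *m S = (1 + -1) *: S - (-1)%:M -> S *m S = 1%:M.
  by rewrite subrr scale0r sub0r raddfN opprK.
have N1_neq0 : (-1 : F) != 0 by rewrite oppr_eq0 oner_neq0.
have [ps [qs part]] := hwp; split.
- have [k Sk] := quadratic_product (oner_neq0 F) hM part.
  move=> r hr monr normr.
  have [|S [unitS SS simS]] := Sk k (or_introl erefl) r hr monr.
    by rewrite expr1n mul1r.
  exists S; split=> //; rewrite mulmxBr mulmxBl mulmx1 mul1mx SS.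
  by rewrite scalerDl scale1r [X in X - _]addrAC addrK subrr.
- have [k Sk] := quadratic_product N1_neq0 hM part.
  exists ((-1) ^+ k); first by rewrite -signr_odd; case: (odd k); [right|left].
  move=> r hr monr /(Sk k (or_introl erefl) r hr monr) [S [unitS SS simS]].
  by exists S; split; auto.
move=> [ps' [qs' [part' not11]]] r hr monr normr.
have deg2 : (1 < deg ps'`_0)%N || (1 < deg qs'`_(size qs').-1)%N.
  have [ps0 qs0 _ pos _ _ _ _] := part'.
  apply/norP; rewrite -!leqNgt => -[p_le q_le]; apply: not11.
  split; apply/eqP; rewrite eqn_leq ?p_le ?q_le pos // mem_cat mem_nth ?orbT //.
  by rewrite prednK.
have [k Sk] := quadratic_product N1_neq0 hM part'.
have Sk' k' : k' = k \/ k' = k.+1 -> pnorm r = (-1) ^+ k' * \det M ->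
    i_adjacent M (castmx (hr, hr) (companion r)).
  move=> k'E normk; have [|S [unitS SS simS]] := Sk k' _ r hr monr normk.
    by case: k'E => [->|->]; [left|right].
  by exists S; split; auto.
have [e normE] : exists b : bool, pnorm r = (-1) ^+ b * \det M.
  case: normr => ->; [exists false|exists true]; first by rewrite mul1r.
  by rewrite expr1 mulN1r.
(* The exponents k and k + 1 have opposite parities. *)
have [ek|ek] := eqVneq e (odd k).
  by apply: (Sk' k); [left|rewrite normE ek signr_odd].
apply: (Sk' k.+1); first by right.
by rewrite normE -[in RHS]signr_odd /=; case: (e) (odd k) ek => [] [].
Qed.
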